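(* Let $\lambda\ge1$ be an integer. Given query access (in the general graph query model) to an $n$-vertex graph $G$, succeeding with probability at least $2/3$ at either of the following tasks requires $\Omega(n^2/\lambda^2)$ queries: (i) produce a proper $(\kappa+\lambda)$-coloring of $G$; (ii) produce an estimate $\hat\kappa$ with $|\hat\kappa-\kappa|\le\lambda$, where $\kappa=\kappa(G)$.
   Context: In the general graph query model the algorithm knows the vertex set $[n]$ and accesses $G$ only via pair queries $\mathrm{Pair}(u,v)$ (returning whether $\{u,v\}\in E(G)$) and neighbor queries $\mathrm{Nbr}(u,j)$ (returning the $j$th neighbor of $u$ in a fixed ordering of its adjacency list, or $\bot$ if none). $\kappa(G)$ is the degeneracy of $G$: the least $k$ such that every induced subgraph has a vertex of degree at most $k$.
   Formalization: The bound holds with one absolute constant for all n and λ, under the added conditions λ < n for task (i) and 2λ+1 < n for task (ii); outside these ranges the task is solvable with 0 queries, so the claim fails there. *)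

(* Defs.v *)
From HB Require Import structures.
From mathcomp Require Import all_boot all_order all_algebra.
From mathcomp Require Import all_classical all_reals all_analysis.

Set Implicit Arguments.
Unset Strict Implicit.
Unset Printing Implicit Defensive.

Import Order.TTheory GRing.Theory Num.Theory.

Local Open Scope ring_scope.

Record sgraph (n : nat) := SGraph {
  adj :> rel 'I_n;
  adj_sym : symmetric adj;
  adj_irr : irreflexive adj }.

Definition deg_in n (G : sgraph n) (S : {set 'I_n}) (v : 'I_n) : nat :=
  #|[set u in S | G v u]|.

(* The empty vertex set is excluded: it has no vertex at all. *)
Definition degenerate n (G : sgraph n) (k : nat) : bool :=
  [forall S : {set 'I_n},
     (S != finset.set0) ==> [exists v in S, (deg_in G S v <= k)%N]].

Lemma degenerate_ex n (G : sgraph n) : exists k, degenerate G k.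
Proof.
exists n; apply/forallP => S; apply/implyP => /set0Pn[v vS].
apply/existsP; exists v; rewrite vS /= /deg_in.
by apply: leq_trans (max_card _) _; rewrite card_ord.
Qed.

Definition degeneracy n (G : sgraph n) : nat := ex_minn (degenerate_ex G).

(* Colors are only counted, so the algorithm may name them by any naturals. *)
Definition proper_coloring n (G : sgraph n) (k : nat) (f : 'I_n -> nat) : Prop :=
  (forall u v, G u v -> f u <> f v) /\ (size (undup (codom f)) <= k)%N.

(* An input of the general graph query model: a graph together with an
   arbitrary but fixed ordering of each adjacency list. *)
Record graph_input (n : nat) := GraphInput {
  graph_of :> sgraph n;
  nbrs : 'I_n -> seq 'I_n;
  nbrs_uniq : forall u, uniq (nbrs u);
  mem_nbrs : forall u v, (v \in nbrs u) = graph_of u v }.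

(* Deterministic adaptive query algorithms with output in O, as decision
   trees.  Positions in adjacency lists are counted from 0, and [None] is the
   answer "no such neighbor" to a neighbor query. *)
Inductive algorithm (n : nat) (O : Type) : Type :=
| Output of O
| Pair of 'I_n & 'I_n & (bool -> algorithm n O)
| Nbr of 'I_n & nat & (option 'I_n -> algorithm n O).

Fixpoint output n O (a : algorithm n O) (G : graph_input n) : O :=
  match a with
  | Output o => o
  | Pair u v k => output (k (G u v)) G
  | Nbr u j k => output (k (onth (nbrs G u) j)) G
  end.

Fixpoint num_queries n O (a : algorithm n O) (G : graph_input n) : nat :=
  match a with
  | Output _ => 0
  | Pair u v k => (num_queries (k (G u v)) G).+1
  | Nbr u j k => (num_queries (k (onth (nbrs G u) j)) G).+1
  end.

Section Randomized.
Context (R : realType) (n : nat) (O : Type).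
Context (d : measure_display) (W : measurableType d) (P : probability W R).

(* A randomized algorithm is a deterministic one depending on a random
   w : W. *)
Implicit Type A : W -> algorithm n O.

Definition makes_at_most (q : nat) A : Prop :=
  forall w G, (num_queries (A w) G <= q)%N.

Definition success_event (task : graph_input n -> O -> Prop) A
    (G : graph_input n) : set W :=
  [set w | task G (output (A w) G)]%classic.

Definition succeeds_with_prob (p : R) (task : graph_input n -> O -> Prop) A
    : Prop :=
  forall G, measurable (success_event task A G) /\
            (p%:E <= P (success_event task A G))%E.

End Randomized.

Definition requires_queries (R : realType) (n : nat) (O : Type) (p : R)
    (task : graph_input n -> O -> Prop) (b : R) : Prop :=
  forall (d : measure_display) (W : measurableType d) (P : probability W R)
         (A : W -> algorithm n O) (q : nat),
    makes_at_most q A -> succeeds_with_prob P p task A -> b <= q%:R.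

Definition coloring_task (n lambda : nat) (G : graph_input n)
    (f : 'I_n -> nat) : Prop :=
  proper_coloring G (degeneracy G + lambda) f.

Definition degeneracy_task (R : realType) (n lambda : nat)
    (G : graph_input n) (khat : R) : Prop :=
  `|khat - (degeneracy G)%:R| <= lambda%:R.

(* Main.v *)
Require Import Defs.
From HB Require Import structures.
From mathcomp Require Import all_boot all_order all_algebra.
From mathcomp Require Import all_classical all_reals all_analysis.
From mathcomp Require Import measurable_realfun zify ring lra.

(* Put s = 2 lambda + 1, and let G0 consist of a clique on 2h vertices and a
   disjoint copy of K_{h,h}.  Split the clique into an odd and an even half, call
   the two sides of K_{h,h} odd and even, and cut each of the four parts into r
   blocks of size s (so h = r s).  For a pair (i, j) of block indices, remove all
   edges between the odd i-th and the even j-th block, both in the clique and in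
   K_{h,h}, and add all edges between the odd i-th block of one component and
   the even j-th block of the other.  Replacing each lost neighbor by its
   counterpart at the same position of the adjacency list keeps all degrees, and
   any query has the same answer on G0 and on the r^2 switched graphs with at
   most one exception.  Still, the K_{h,h} part can be peeled off first, so
   switching lowers the degeneracy from 2h - 1 to at most 2h - 1 - s; hence no
   output is correct both for G0 and for a switched graph, and r^2 / 3 queries
   are needed by averaging. *)

Set Implicit Arguments.
Unset Strict Implicit.
Unset Printing Implicit Defensive.

Import Order.TTheory GRing.Theory Num.Theory.

Local Open Scope ring_scope.

Section Indistinguishability.
Context (n : nat) (O : Type) (I : finType).
Context (G0 : graph_input n) (G : I -> graph_input n).

Definition disturbed_once : Prop :=
  (forall u v i j, G i u v <> G0 u v -> G j u v <> G0 u v -> i = j) /\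
  (forall u k i j, onth (nbrs (G i) u) k <> onth (nbrs G0 u) k ->
     onth (nbrs (G j) u) k <> onth (nbrs G0 u) k -> i = j).

Lemma output_eq_off (a : algorithm n O) : disturbed_once ->
  exists2 D : {set I}, (#|D| <= num_queries a G0)%N &
    forall i, i \notin D -> output a (G i) = output a G0.
Proof.
move=> [dpair dnbr].
have card_le1 (P : pred I) : (forall i j, P i -> P j -> i = j) ->
    (#|[set i | P i]%SET| <= 1)%N.
  by move=> uP; apply/card_le1_eqP => i j; rewrite !inE => hi hj; apply: uP.
elim: a => [x|u v f IH|u k f IH] /=.
- by exists finset.set0 => //; rewrite cards0.
- have [D leD eqD] := IH (G0 u v).
  exists ([set i | G i u v != G0 u v]%SET :|: D).
    rewrite -add1n; apply: leq_trans (leq_card_setU _ _) (leq_add _ leD).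
    by apply: card_le1 => i j /eqP ni /eqP nj; apply: dpair ni nj.
  by move=> i; rewrite !inE negb_or negbK => /andP[/eqP-> /eqD].
- have [D leD eqD] := IH (onth (nbrs G0 u) k).
  exists ([set i | onth (nbrs (G i) u) k != onth (nbrs G0 u) k]%SET :|: D).
    rewrite -add1n; apply: leq_trans (leq_card_setU _ _) (leq_add _ leD).
    by apply: card_le1 => i j /eqP ni /eqP nj; apply: dnbr ni nj.
  by move=> i; rewrite !inE negb_or negbK => /andP[/eqP-> /eqD].
Qed.

(* Integrate over the random seed w the pointwise bound
   sum_i (1[success on G i] + 1[success on G0]) <= #|I| + q: if w succeeds on
   G0, it succeeds only on those G i that its queries tell apart from G0. *)
Lemma disturbed_once_lower_bound (R : realType)
    (task : graph_input n -> O -> Prop) :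
  disturbed_once ->
  (forall i o, task G0 o -> task (G i) o -> False) ->
  requires_queries (2 / 3 : R) task (#|I|%:R / 3).
Proof.
move=> dG incompat d W P A q leq_q succ.
pose E H := success_event task A H.
have mE H : measurable (E H) by have [] := succ H.
have leP H : ((2 / 3)%:E <= P (E H))%E by have [] := succ H.
pose f i w : \bar R := ((\1_(E (G i)) w)%:E + (\1_(E G0) w)%:E)%E.
have mind H : measurable_fun [set: W]%classic (fun w => (\1_(E H) w)%:E : \bar R).
  by apply/measurable_EFinP; apply: measurable_indic.
have ind0 H w : (0 <= (\1_(E H) w : R)%:E)%E by rewrite lee_fin.
have mf i : measurable_fun [set: W]%classic (f i).
  by apply: emeasurable_funD; apply: mind.
have f0 i w : (0 <= f i w)%E by apply: adde_ge0.
have intf i : (\int[P]_w f i w = P (E (G i)) + P (E G0))%E.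
  rewrite (ge0_integralD P measurableT (f1 := fun w => (\1_(E (G i)) w)%:E)
    (f2 := fun w => (\1_(E G0) w)%:E)) //.
  by rewrite !integral_indic // !setIT.
have lower : ((#|I|%:R * (4 / 3))%:E <= \int[P]_w (\sum_(i : I) f i w))%E.
  rewrite ge0_integral_sum //.
  have -> : ((#|I|%:R * (4 / 3))%:E = \sum_(i : I) (4 / 3 : R)%:E)%E.
    by rewrite sumEFin sumr_const cardT -cardE mulr_natl.
  apply: lee_sum => i _; rewrite intf.
  apply: le_trans (leeD (leP _) (leP _)).
  by rewrite -EFinD lee_fin; lra.
have upper : (\int[P]_w (\sum_(i : I) f i w) <= (#|I|%:R + q%:R)%:E)%E.
  have -> : ((#|I|%:R + q%:R)%:E
             = \int[P]_w (cst (#|I|%:R + q%:R)%:E w) :> \bar R)%E.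
    by rewrite integral_cst // -[RHS]/(_ * P _)%E probability_setT mule1.
  apply: ge0_le_integral => //.
  - by move=> w _; apply: sume_ge0.
  - exact: emeasurable_sum.
  move=> w _.
  have [D leD eqD] := output_eq_off (A w) dG.
  have sum_ind (B : {set I}) :
      \sum_(i : I) (i \in B)%:R = #|B|%:R :> R.
    by rewrite -natr_sum -big_mkcond sum1_card.
  rewrite sumEFin lee_fin big_split /= sumr_const cardT -cardE addrC.
  rewrite (indicE _ (E G0)); case: (boolP (w \in E G0)) => [|_].
    rewrite inE => sw; rewrite lerD2l.
    apply: (@le_trans _ _ (\sum_(i : I) (i \in D)%:R)); last first.
      by rewrite sum_ind ler_nat (leq_trans leD).
    apply: ler_sum => i _; rewrite indicE ler_nat.
    case: (boolP (i \in D)) => [_|/eqD eqi]; first exact: leq_b1.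
    case: (boolP (w \in E (G i))) => //; rewrite inE /E /success_event /= eqi.
    by move=> si; case: (incompat i _ sw si).
  rewrite mul0rn add0r ler_wpDr //.
  have -> : #|I|%:R = \sum_(i : I) 1 :> R by rewrite sumr_const cardT -cardE.
  by apply: ler_sum => i _; rewrite indicE lern1 leq_b1.
have := le_trans lower upper; rewrite lee_fin; lra.
Qed.

End Indistinguishability.

Section CliqueBounds.
Context (n : nat).
Implicit Types (G : sgraph n) (S : {set 'I_n}).

Definition is_clique G S : Prop := {in S &, forall u v, u != v -> G u v}.

Lemma degeneracy_le G k : degenerate G k -> (degeneracy G <= k)%N.
Proof. by rewrite /degeneracy; case: ex_minnP => m _; apply. Qed.

Lemma clique_degeneracy G S : is_clique G S -> (#|S| <= (degeneracy G).+1)%N.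
Proof.
move=> cS; rewrite /degeneracy; case: ex_minnP => k /forallP/(_ S) + _.
have [->|_] := eqVneq S finset.set0; first by rewrite cards0.
move=> /existsP[v /andP[vS]]; rewrite -ltnS => /(leq_trans _); apply.
rewrite (cardsD1 v S) vS add1n ltnS; apply: subset_leq_card.
apply/fintype.subsetP => u; rewrite !inE => /andP[uv uS].
by rewrite uS cS // eq_sym.
Qed.

Lemma clique_colors G S k (f : 'I_n -> nat) :
  is_clique G S -> proper_coloring G k f -> (#|S| <= k)%N.
Proof.
move=> cS [fG]; apply: leq_trans.
rewrite cardE -(size_map f) uniq_leq_size //.
  rewrite map_inj_in_uniq ?enum_uniq // => u v; rewrite !mem_enum => uS vS.
  by move=> fuv; apply/eqP/negPn/negP => /(cS u v uS vS)/fG.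
by move=> c /mapP[u _ ->]; rewrite mem_undup codom_f.
Qed.

Context (lambda : nat) (G0 G1 : graph_input n) (S : {set 'I_n}).

Lemma coloring_incompatible f : is_clique G0 S ->
  (degeneracy G1 + lambda < #|S|)%N ->
  coloring_task lambda G0 f -> coloring_task lambda G1 f -> False.
Proof.
move=> cS ltS [fG _] [_ le1].
by have := clique_colors cS (conj fG le1); rewrite leqNgt ltS.
Qed.

Lemma degeneracy_incompatible (R : realType) (k : R) : is_clique G0 S ->
  (degeneracy G1 + lambda.*2.+1 < #|S|)%N ->
  degeneracy_task lambda G0 k -> degeneracy_task lambda G1 k -> False.
Proof.
move=> cS ltS; rewrite /degeneracy_task !ler_norml => /andP[h0 _] /andP[_ h1].
have : (degeneracy G1 + lambda + lambda + 1)%:R <= (degeneracy G0)%:R :> R.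
  by rewrite ler_nat; have := clique_degeneracy cS; lia.
rewrite !natrD; lra.
Qed.

End CliqueBounds.

Section CanonicalInput.
Context (n : nat) (G : sgraph n).

Lemma enum_nbrs_uniq (u : 'I_n) : uniq (enum (G u)).
Proof. exact: enum_uniq. Qed.

Lemma mem_enum_nbrs (u v : 'I_n) : (v \in enum (G u)) = G u v.
Proof. by rewrite mem_enum. Qed.

Definition enum_input : graph_input n :=
  GraphInput enum_nbrs_uniq mem_enum_nbrs.

End CanonicalInput.

Section TrivialGraphs.
Context (n : nat).

Lemma neq_op_sym : symmetric (fun u v : 'I_n => u != v).
Proof. by move=> u v; rewrite eq_sym. Qed.

Lemma neq_op_irr : irreflexive (fun u v : 'I_n => u != v).
Proof. by move=> u; rewrite eqxx. Qed.

Definition complete_graph := SGraph neq_op_sym neq_op_irr.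

Definition empty_graph :=
  @SGraph n (fun _ _ => false) (fun _ _ => erefl) (fun _ => erefl).

Lemma degeneracy_empty : degeneracy empty_graph = 0%N.
Proof.
apply/eqP; rewrite -leqn0; apply/degeneracy_le/forallP => S.
apply/implyP => /set0Pn[v vS]; apply/existsP; exists v; rewrite vS /=.
by rewrite leqn0 cards_eq0; apply/eqP/setP => u; rewrite !inE andbF.
Qed.

Lemma complete_empty_disturbed_once :
  disturbed_once (enum_input complete_graph)
    (fun _ : unit => enum_input empty_graph).
Proof. by split=> ? ? [] []. Qed.

End TrivialGraphs.

Section SwitchedGraphs.
Context (r s : nat).

(* (a, p, i, o) is the o-th vertex of the i-th block of the half of parity p
   of the clique (a = true) or of the bipartite graph (a = false). *)
Definition vertex : Type := bool * bool * 'I_r * 'I_s.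
HB.instance Definition _ := Finite.on vertex.

Implicit Types (x y : vertex) (sg : 'I_r * 'I_r).

Definition side x : bool := x.1.1.1.
Definition parity x : bool := x.1.1.2.
Definition block x : 'I_r := x.1.2.
Definition flip x : vertex := (~~ side x, parity x, block x, x.2).

Definition base_rel : rel vertex := fun x y =>
  (side x == side y) && (if side x then x != y else parity x != parity y).

Definition marked sg x : bool := block x == (if parity x then sg.1 else sg.2).

Definition switch sg x y : bool :=
  [&& parity x != parity y, marked sg x & marked sg y].

Definition twist sg x y : vertex := if switch sg x y then flip y else y.

Definition switched_rel sg : rel vertex := fun x y => base_rel x (twist sg x y).

Lemma base_rel_opposite x y :
  parity x != parity y -> base_rel x y = (side x == side y).
Proof.
move=> pxy; rewrite /base_rel pxy; case: ifP; rewrite ?andbT // => _.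
by apply/andb_idr => _; apply: contraNneq pxy => ->.
Qed.

Lemma switchC sg x y : switch sg x y = switch sg y x.
Proof. by rewrite /switch eq_sym [marked sg x && _]andbC. Qed.

Lemma base_rel_sym : symmetric base_rel.
Proof.
move=> x y; rewrite /base_rel (eq_sym (side x)) (eq_sym x) (eq_sym (parity x)).
by case: eqP => //= ->.
Qed.

Lemma base_rel_irr : irreflexive base_rel.
Proof. by move=> x; rewrite /base_rel !eqxx; case: ifP. Qed.

Lemma switched_relE sg x y : switched_rel sg x y =
  if switch sg x y then side x != side y else base_rel x y.
Proof.
rewrite /switched_rel /twist; case: ifP => // /and3P[pxy _ _].
rewrite base_rel_opposite // -[side (flip y)]/(~~ side y).
by case: (side x); case: (side y).
Qed.

Lemma switched_rel_sym sg : symmetric (switched_rel sg).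
Proof.
by move=> x y; rewrite !switched_relE switchC base_rel_sym (eq_sym (side x)).
Qed.

Lemma switched_rel_irr sg : irreflexive (switched_rel sg).
Proof. by move=> x; rewrite switched_relE /switch eqxx base_rel_irr. Qed.

Lemma twistK sg x : involutive (twist sg x).
Proof.
move=> y; rewrite /twist; case: (boolP (switch sg x y)) => [sw|/negbTE-> //].
have -> : switch sg x (flip y) by [].
by case: y sw => [[[a p] i] k] _; rewrite /flip /= negbK.
Qed.

Lemma switch_inj sg sg' x y : switch sg x y -> switch sg' x y -> sg = sg'.
Proof.
case: sg sg' => [i j] [i' j'] /and3P[pxy /eqP/= mx /eqP/= my].
move=> /and3P[_ /eqP/= mx' /eqP/= my'].
move: pxy mx my mx' my'.
by case: (parity x) (parity y) => [] [] //= _ -> -> -> ->.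
Qed.

Lemma card_side (a : bool) : #|[set x | side x == a]%SET| = (2 * (r * s))%N.
Proof.
have -> : [set x | side x == a]%SET =
    finset.setX (finset.setX (finset.setX [set a]%SET [set: bool]%SET)
      [set: 'I_r]%SET) [set: 'I_s]%SET.
  by apply/setP => -[[[b p] i] k]; rewrite !inE !andbT.
by rewrite !cardsX cards1 !cardsT card_bool !card_ord mul1n mulnA.
Qed.

Lemma card_half (a p : bool) :
  #|[set x | (side x == a) && (parity x == p)]%SET| = (r * s)%N.
Proof.
have -> : [set x | (side x == a) && (parity x == p)]%SET =
    finset.setX (finset.setX (finset.setX [set a]%SET [set p]%SET)
      [set: 'I_r]%SET) [set: 'I_s]%SET.
  by apply/setP => -[[[b p'] i] k]; rewrite !inE !andbT.
by rewrite !cardsX !cards1 !cardsT !card_ord !mul1n.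
Qed.

Lemma card_block (a p : bool) (i : 'I_r) :
  #|[set x | [&& side x == a, parity x == p & block x == i]]%SET| = s.
Proof.
have -> : [set x | [&& side x == a, parity x == p & block x == i]]%SET =
    finset.setX (finset.setX (finset.setX [set a]%SET [set p]%SET)
      [set i]%SET) [set: 'I_s]%SET.
  by apply/setP => -[[[b p'] i'] k]; rewrite !inE !andbT !andbA.
by rewrite !cardsX !cards1 !cardsT !card_ord !mul1n.
Qed.

Lemma card_side_diff_block (i : 'I_r) (p : bool) x :
  side x -> ~~ ((parity x == p) && (block x == i)) ->
  #|[set y | [&& side y, y != x & ~~ ((parity y == p) && (block y == i))]]%SET|
    = (2 * (r * s) - s - 1)%N.
Proof.
move=> sx nx.
pose A : {set vertex} := [set y | side y == true]%SET.
pose C : {set vertex} :=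
  [set y | [&& side y == true, parity y == p & block y == i]]%SET.
have -> : [set y | [&& side y, y != x &
      ~~ ((parity y == p) && (block y == i))]]%SET = (A :\: C) :\ x.
  apply/setP => y; rewrite !inE eqb_id.
  by case: (y != x) (side y) ((parity y == p) && _) => [] [] [].
have := cardsD1 x (A :\: C).
have -> : x \in A :\: C by rewrite !inE eqb_id sx /= andbT.
have sCA : C \subset A by apply/fintype.subsetP => y; rewrite !inE => /and3P[].
have := cardsD A C; rewrite (finset.setIidPr sCA) card_side card_block.
by move=> -> ->; rewrite addKn.
Qed.

Lemma card_switched_bipartite sg x :
  ~~ side x -> (#|[set y | switched_rel sg x y]%SET| <= r * s)%N.
Proof.
move=> nx.
rewrite -(card_half false (~~ parity x)) -(card_imset _ (can_inj (twistK sg x))).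
apply: subset_leq_card; apply/fintype.subsetP => z /imsetP[y].
rewrite !inE /switched_rel => + ->; rewrite /base_rel (negbTE nx).
by case: (parity x) (parity (twist sg x y)) => [] [] /andP[] // /eqP <-.
Qed.

Context (n : nat) (le_n : (#|{: vertex}| <= n)%N).

Definition enc x : 'I_n := widen_ord le_n (enum_rank x).

Definition dec (u : 'I_n) : option vertex :=
  omap enum_val (insub (u : nat) : option 'I_#|{: vertex}|).

Lemma encK x : dec (enc x) = Some x.
Proof. by rewrite /dec /enc /= (valK (enum_rank x)) /= enum_rankK. Qed.

Lemma dec_enc u x : dec u = Some x -> u = enc x.
Proof.
rewrite /dec; case: insubP => //= k _ ku [<-].
by apply: val_inj; rewrite /= enum_valK ku.
Qed.

Lemma enc_inj : injective enc.
Proof. by move=> x y e; apply/Some_inj; rewrite -!encK e. Qed.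

Definition lift_rel (e : rel vertex) : rel 'I_n := fun u v =>
  if (dec u, dec v) is (Some x, Some y) then e x y else false.

Lemma lift_rel_sym e : symmetric e -> symmetric (lift_rel e).
Proof.
by move=> se u v; rewrite /lift_rel; case: (dec u) (dec v) => [x|] [y|].
Qed.

Lemma lift_rel_irr e : irreflexive e -> irreflexive (lift_rel e).
Proof. by move=> ie u; rewrite /lift_rel; case: (dec u). Qed.

Definition base_graph : sgraph n :=
  SGraph (lift_rel_sym base_rel_sym) (lift_rel_irr base_rel_irr).

Definition switched_graph sg : sgraph n :=
  SGraph (lift_rel_sym (@switched_rel_sym sg))
    (lift_rel_irr (@switched_rel_irr sg)).

Definition lift_twist sg (u v : 'I_n) : 'I_n :=
  if (dec u, dec v) is (Some x, Some y) then enc (twist sg x y) else v.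

Lemma lift_twistK sg u : involutive (lift_twist sg u).
Proof.
move=> v; rewrite {2}/lift_twist; case du: (dec u) => [x|]; last first.
  by rewrite /lift_twist du.
case dv: (dec v) => [y|]; last by rewrite /lift_twist du dv.
by rewrite /lift_twist du encK twistK -(dec_enc dv).
Qed.

Definition switched_nbrs sg (u : 'I_n) : seq 'I_n :=
  [seq lift_twist sg u v | v <- nbrs (enum_input base_graph) u].

Lemma switched_nbrs_uniq sg u : uniq (switched_nbrs sg u).
Proof.
by rewrite (map_inj_uniq (can_inj (lift_twistK sg u))) nbrs_uniq.
Qed.

Lemma mem_switched_nbrs sg u v :
  (v \in switched_nbrs sg u) = switched_graph sg u v.
Proof.
rewrite -[v in LHS](lift_twistK sg u) (mem_map (can_inj (lift_twistK sg u))).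
rewrite mem_nbrs /= /lift_rel /lift_twist; case du: (dec u) => [x|] //.
by case dv: (dec v) => [y|]; rewrite ?encK // dv.
Qed.

Definition switched_input sg : graph_input n :=
  GraphInput (switched_nbrs_uniq sg) (mem_switched_nbrs sg).

Lemma lift_twist_neq sg u v : lift_twist sg u v <> v ->
  exists x y, [/\ dec u = Some x, dec v = Some y & switch sg x y].
Proof.
rewrite /lift_twist; case: (dec u) => [x|] //; case dv: (dec v) => [y|] //.
move=> ne; exists x, y; split=> //; apply/negPn/negP => /negbTE nsw.
by apply: ne; rewrite /twist nsw -(dec_enc dv).
Qed.

Lemma lift_twist_inj sg sg' u v :
  lift_twist sg u v <> v -> lift_twist sg' u v <> v -> sg = sg'.
Proof.
move=> /lift_twist_neq[x [y [dx dy sw]]] /lift_twist_neq[x' [y' []]].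
by rewrite dx dy => -[<-] [<-]; apply: switch_inj.
Qed.

Lemma switched_disturbed_once :
  disturbed_once (enum_input base_graph) switched_input.
Proof.
split=> [u v sg sg'|u k sg sg'] /=.
  rewrite /lift_rel; case: (dec u) => [x|] //; case: (dec v) => [y|] //.
  rewrite !switched_relE; case: (boolP (switch sg x y)) => // sw _.
  by case: (boolP (switch sg' x y)) => // sw' _; apply: switch_inj sw'.
rewrite /switched_nbrs !onth_map /=; case: (onth _ k) => [v|] //= ne ne'.
by apply: (@lift_twist_inj _ _ u v); [move=> e; apply: ne|move=> e; apply: ne'];
  rewrite e.
Qed.

Definition planted_clique : {set 'I_n} := enc @: [set x | side x == true]%SET.

Lemma planted_clique_clique : is_clique base_graph planted_clique.
Proof.
move=> _ _ /imsetP[x + ->] /imsetP[y + ->]; rewrite !inE => /eqP sx /eqP sy.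
by rewrite (inj_eq enc_inj) /= /lift_rel !encK /base_rel sx sy.
Qed.

Lemma card_planted_clique : #|planted_clique| = (2 * (r * s))%N.
Proof. by rewrite card_imset ?card_side //; apply: enc_inj. Qed.

Lemma deg_in_switched sg (S : {set 'I_n}) x (B : {set vertex}) :
  (forall y, switched_rel sg x y -> enc y \in S -> y \in B) ->
  (deg_in (switched_graph sg) S (enc x) <= #|B|)%N.
Proof.
move=> sB; rewrite -(card_imset _ enc_inj); apply: subset_leq_card.
apply/fintype.subsetP => v; rewrite !inE /= /lift_rel encK => /andP[vS].
case dv: (dec v) => [y|] // xy; rewrite (dec_enc dv) in vS *.
by rewrite imset_f // sB.
Qed.

(* Peel off the isolated vertices and the bipartite part first: their degrees
   are unchanged.  The marked odd block of the clique comes next, as it has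
   lost its edges to the marked even block. *)
Lemma degeneracy_switched sg : (1 < r)%N -> (0 < s)%N ->
  (degeneracy (switched_graph sg) <= 2 * (r * s) - s - 1)%N.
Proof.
move=> r1 s0; apply/degeneracy_le/forallP => S; apply/implyP => /set0Pn[v0 v0S].
have [/existsP[v /andP[vS /eqP dv]]|/existsPn alldec] :=
  boolP [exists v in S, dec v == None].
  apply/existsP; exists v; rewrite vS /=.
  have -> : deg_in (switched_graph sg) S v = 0%N; last by [].
  apply/eqP; rewrite cards_eq0; apply/eqP/setP => u.
  by rewrite !inE /= /lift_rel dv andbF.
have decS v : v \in S -> exists2 x, v = enc x & enc x \in S.
  move=> vS; have := alldec v; rewrite vS /=; case dv: (dec v) => [x|] // _.
  by exists x; rewrite -?(dec_enc dv).
have [/existsP[x /andP[xS nx]]|/existsPn allside] :=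
  boolP [exists x, (enc x \in S) && ~~ side x].
  apply/existsP; exists (enc x); rewrite xS /=.
  have := @deg_in_switched sg S x [set y | switched_rel sg x y]%SET.
  have := card_switched_bipartite sg nx.
  move=> h1 /(_ _)/leq_trans; apply; first by move=> y; rewrite inE.
  by apply: leq_trans h1 _; nia.
have sideS x : enc x \in S -> side x.
  by move=> xS; have := allside x; rewrite xS negbK.
have [/existsP[x /and3P[xS px mx]]|/existsPn unmarked] :=
  boolP [exists x, [&& enc x \in S, parity x & block x == sg.1]].
  apply/existsP; exists (enc x); rewrite xS /=.
  rewrite -(@card_side_diff_block sg.2 false x) ?sideS ?px //.
  apply: deg_in_switched => y + yS.
  rewrite switched_relE inE /switch /marked /base_rel (eq_sym y).
  rewrite (sideS _ xS) (sideS _ yS) px mx /=.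
  by case: (parity y) => /=; last case: (block y == _); rewrite ?andbT.
have [x _ xS] := decS _ v0S.
apply/existsP; exists (enc x); rewrite xS /=.
rewrite -(@card_side_diff_block sg.1 true x) ?sideS //; last first.
  by have := unmarked x; rewrite xS /=; case: (parity x).
apply: deg_in_switched => y xy yS; rewrite inE sideS //=.
apply/andP; split.
  by apply/eqP => yx; rewrite yx switched_rel_irr in xy.
by have := unmarked y; rewrite yS /=; case: (parity y).
Qed.

End SwitchedGraphs.

Lemma card_vertex r s : #|{: vertex r s}| = (4 * (r * s))%N.
Proof. by rewrite !card_prod !card_bool !card_ord mulnA. Qed.

(* For [n < 8 (2 lambda + 1)] the bound is at most 1/3, so it is enough that one
   query is needed, and the complete and the empty graph show this. *)
Lemma switching_lower_bound (R : realType) (n lambda : nat) (O : Type)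
    (task : graph_input n -> O -> Prop) :
  (1 <= lambda)%N ->
  (forall (G0 G1 : graph_input n) (S : {set 'I_n}) x, is_clique G0 S ->
     (degeneracy G1 + lambda.*2.+1 < #|S|)%N \/
       #|S| = n /\ degeneracy G1 = 0%N ->
     task G0 x -> task G1 x -> False) ->
  requires_queries (2 / 3 : R) task
    ((3 * 24 ^+ 2)^-1 * (n%:R ^+ 2 / lambda%:R ^+ 2)).
Proof.
move=> l1 incompat d W P A q hq hs.
have l0 : 0 < lambda%:R :> R by rewrite ltr0n.
suff [N leN leq] : exists2 N : nat,
    n%:R ^+ 2 <= N%:R * (24 * lambda%:R) ^+ 2 :> R & N%:R / 3 <= q%:R :> R.
  apply: le_trans leq.
  (* [field] would expand the literal 24 in unary. *)
  have [K0 K0_gt0 K0E] : exists2 K0 : R, 0 < K0 & 24 = K0 by exists 24.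
  rewrite K0E in leN *; rewrite ler_pdivrMl ?mulr_gt0 ?exprn_gt0 //.
  rewrite ler_pdivrMr ?exprn_gt0 //; apply: le_trans leN _.
  by rewrite le_eqVlt; apply/orP; left; apply/eqP; field.
set s := lambda.*2.+1.
have [n8|n8] := leqP (8 * s) n.
  pose r := (n %/ (4 * s))%N.
  have ler : (4 * (r * s) <= n)%N.
    by rewrite mulnCA leq_trunc_div.
  have le_n : (#|{: vertex r s}| <= n)%N by rewrite card_vertex.
  have r2 : (1 < r)%N by rewrite leq_divRL // mulnA.
  exists (r * r)%N.
    have ltn : (n < r.+1 * (4 * s))%N by rewrite ltn_ceil.
    have le24 : (n <= 24 * (r * lambda))%N by rewrite /s in ltn *; nia.
    have -> : (r * r)%:R * (24 * lambda%:R) ^+ 2 =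
        (24 * (r * lambda))%:R ^+ 2 :> R.
      by rewrite !natrM !exprMn expr2 mulrCA.
    by rewrite ler_sqr ?nnegrE // ler_nat.
  have -> : (r * r)%N = #|{: 'I_r * 'I_r}| by rewrite card_prod !card_ord.
  apply: (disturbed_once_lower_bound (switched_disturbed_once le_n) _ hq hs).
  move=> sg x; apply: (incompat _ _ (planted_clique le_n)).
    exact: planted_clique_clique.
  left; rewrite card_planted_clique /=.
  have := degeneracy_switched le_n sg r2 (ltn0Sn _).
  by rewrite -/s; have : (0 < s)%N by []; nia.
exists 1%N.
  have le24 : (n <= 24 * lambda)%N by rewrite /s in n8; lia.
  rewrite mul1r -natrM.
  by rewrite ler_sqr ?nnegrE // ler_nat.
suff : #|{: unit}|%:R / 3 <= q%:R :> R by rewrite card_unit.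
apply: (disturbed_once_lower_bound (@complete_empty_disturbed_once n) _ hq hs).
move=> _ x; apply: (incompat _ _ [set: 'I_n]%SET) => //.
by right; rewrite cardsT card_ord degeneracy_empty.
Qed.

(* The ranges of lambda are those where the tasks need a query at all: if
   n <= lambda, coloring all vertices differently solves (i), and if
   n <= 2 lambda + 1, the constant estimate (n - 1)/2 solves (ii). *)
Theorem theorem5p13 (R : realType) :
  exists2 c : R, 0 < c &
    forall n lambda : nat, (1 <= lambda)%N ->
      ((lambda < n)%N ->
         requires_queries (2 / 3 : R) (@coloring_task n lambda)
           (c * (n%:R ^+ 2 / lambda%:R ^+ 2))) /\
      ((lambda.*2.+1 < n)%N ->
         requires_queries (2 / 3 : R) (@degeneracy_task R n lambda)
           (c * (n%:R ^+ 2 / lambda%:R ^+ 2))).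
Proof.
exists (3 * 24 ^+ 2)^-1; first by rewrite invr_gt0 mulr_gt0 ?exprn_gt0.
move=> n lambda l1; split=> ltn; apply: switching_lower_bound => // G0 G1 S x cS.
  by move=> ltS; apply: coloring_incompatible cS _; lia.
by move=> ltS; apply: degeneracy_incompatible cS _; lia.
Qed.
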